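(* For all $k,\ell\in\{0,1,2,3,4\}$, every nonzero suffix state $R$ of the order $O_{k,\ell}$ defined in the context satisfies $$\|R\|<\widehat R,\qquad \widehat R:=\frac{27131}{25000}=1.08524.$$
   Context: Put $s=\frac{766}{\sqrt{625565}}$, $c=\frac{197}{\sqrt{625565}}$, $\mu=\frac{10973}{125000}$, and define vectors in $\mathbb R^2$: $d_1=d_2=(0,-1)$; $P_1=\mu(c,-s)$, $P_2=2c(s,c)$, $P_3=2c\mu(s^2-c^2,2sc)$, $P_4=\mu(3c-4c^3,4s^3-3s)$; $Z_1=(2sc,s^2-c^2)$, $Z_2=(-2sc,s^2-c^2)$; $Q_1=\mu(-(3c-4c^3),4s^3-3s)$, $Q_2=2c\mu(-(s^2-c^2),2sc)$, $Q_3=2c(-s,c)$, $Q_4=\mu(-c,-s)$. For $k,\ell\in\{0,1,2,3,4\}$ let $O_{k,\ell}$ be the sequence of these 12 vectors $$(P_k,\dots,P_1),\,d_1,\,(P_{k+1},\dots,P_4),\,Z_1,\,Z_2,\,(Q_1,\dots,Q_{4-\ell}),\,d_2,\,(Q_4,\dots,Q_{5-\ell}),$$ where empty ranges are omitted (the block $(P_k,\dots,P_1)$ has decreasing indices, $(P_{k+1},\dots,P_4)$ and $(Q_1,\dots,Q_{4-\ell})$ increasing indices, $(Q_4,\dots,Q_{5-\ell})$ decreasing indices). A suffix state of a sequence $(w_1,\dots,w_{12})$ is a sum $\sum_{j\ge i}w_j$ with $1\le i\le 12$. $\|\cdot\|$ is the Euclidean norm. *)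

(* Defs.v *)
From Stdlib Require Import Reals List.
From Coquelicot Require Import Coquelicot.
Import ListNotations.
Open Scope R_scope.

(* The plane is R * R.  Coquelicot's [norm] on a product of normed modules is
   [prod_norm], i.e. sqrt (|x|^2 + |y|^2): on R * R it is the Euclidean norm
   (not the sup norm). *)
Definition vec : Type := (R * R)%type.

Definition s : R := 766 / sqrt 625565.
Definition c : R := 197 / sqrt 625565.
Definition mu : R := 10973 / 125000.

Definition d1 : vec := (0, -1).
Definition d2 : vec := (0, -1).

Definition P1 : vec := scal mu ((c, - s) : vec).
Definition P2 : vec := scal (2 * c) ((s, c) : vec).
Definition P3 : vec := scal (2 * c * mu) ((s ^ 2 - c ^ 2, 2 * s * c) : vec).
Definition P4 : vec := scal mu ((3 * c - 4 * c ^ 3, 4 * s ^ 3 - 3 * s) : vec).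

Definition Z1 : vec := (2 * s * c, s ^ 2 - c ^ 2).
Definition Z2 : vec := (- 2 * s * c, s ^ 2 - c ^ 2).

Definition Q1 : vec := scal mu ((- (3 * c - 4 * c ^ 3), 4 * s ^ 3 - 3 * s) : vec).
Definition Q2 : vec := scal (2 * c * mu) ((- (s ^ 2 - c ^ 2), 2 * s * c) : vec).
Definition Q3 : vec := scal (2 * c) ((- s, c) : vec).
Definition Q4 : vec := scal mu ((- c, - s) : vec).

Definition P : list vec := [P1; P2; P3; P4].
Definition Q : list vec := [Q1; Q2; Q3; Q4].

(* (P_k, ..., P_1), d_1, (P_{k+1}, ..., P_4), Z_1, Z_2,
   (Q_1, ..., Q_{4-l}), d_2, (Q_4, ..., Q_{5-l}) *)
Definition order (k l : nat) : list vec :=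
  rev (firstn k P) ++ [d1] ++ skipn k P ++ [Z1; Z2] ++
  firstn (4 - l) Q ++ [d2] ++ rev (skipn (4 - l) Q).

Definition vsum (w : list vec) : vec := fold_right plus zero w.

(* The index i is 1-based: the terms w_i, w_{i+1}, ... are [skipn (i - 1) w]. *)
Definition suffix_state (w : list vec) (v : vec) : Prop :=
  exists i : nat, (1 <= i <= length w)%nat /\ v = vsum (skipn (i - 1) w).

Definition Rhat : R := 27131 / 25000.

(* Main.v *)
From Stdlib Require Import Reals List Lia Lra Nsatz.
From Coquelicot Require Import Coquelicot.
Require Import Defs.
Import ListNotations.
Open Scope R_scope.

(** Up to the sign of x, the second half of the sequence is the first half of
    another member of the family read backwards.  Write [half l] for
    P_l, ..., P_1, d_1, P_{l+1}, ..., P_4.  The reflection [mirror] in the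
    vertical axis sends P_i to Q_{5-i} and d_1 to d_2, so [order k l] is
    [half k], then Z_1, Z_2, then the reflection of the reversal of [half l]
    ([order_mirror]).  The twelve vectors sum to zero ([vsum_halves]), because
    the halves together have vertical part 2(2c^2 - 1) = -2(s^2 - c^2) and
    their horizontal parts cancel.

    A suffix state is therefore, up to a sign or a reflection, a prefix sum
    of some [half k], except for the one state that starts at Z_2.  So all
    k and l reduce to a bound on the prefixes of one half
    ([norm_prefix_half_lt]) and one separate state ([norm_middle_lt]).

    A prefix of [half k] that stops before d_1 is a sum of some of the P_i,
    and |P_1| + ... + |P_4| = 2 mu + 2c + 2c mu is already below the bound.
    A longer prefix is, after reordering, d_1 + P_1 + ... + P_m with m >= k, a
    point of a single polygonal path independent of k.  Since s^2 + c^2 = 1, one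
    may write c = cos t and s = sin t.  Then d_1 + P_2 is the unit vector
    (sin 2t, -cos 2t), the vectors P_1 and P_1 + P_3 have length mu, and the
    scalar products of P_1 with d_1, of P_1 with d_1 + P_2 and of P_1 + P_3
    with d_1 + P_2 are all equal to mu s.  Hence for m = 1, 2, 3 the squared
    norm is exactly 1 + mu^2 + 2 mu s, whose square root is just below the
    bound ([norm_down_P_lt]).  The start m = 0 and the endpoint m = 4 are well
    inside.

    The state that starts at Z_2 is horizontal, of length
    4sc + 2 mu c (3 - 4c^2), which is the other tight case.  Both tight cases
    have margin about 2e-6, so rational bounds on s and c to five
    or six decimals decide them. *)

(** * Sums and norms of finite sequences of plane vectors *)

Lemma vec_eq (u v : vec) : fst u = fst v -> snd u = snd v -> u = v.
Proof. destruct u, v; simpl; intros; subst; reflexivity. Qed.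

Lemma vsum_app (w1 w2 : list vec) :
  vsum (w1 ++ w2) = plus (vsum w1) (vsum w2).
Proof.
  induction w1 as [|u w1 IH]; simpl.
  - now rewrite plus_zero_l.
  - now rewrite IH, plus_assoc.
Qed.

Lemma vsum_rev (w : list vec) : vsum (rev w) = vsum w.
Proof.
  induction w as [|u w IH]; simpl; [reflexivity|].
  rewrite vsum_app, IH; simpl.
  rewrite plus_zero_r. apply plus_comm.
Qed.

Lemma plus_eq_zero_opp {G : AbelianGroup} (a b : G) :
  plus a b = zero -> b = opp a.
Proof.
  intros H. transitivity (plus (plus (opp a) a) b).
  - now rewrite plus_opp_l, plus_zero_l.
  - rewrite <- plus_assoc. etransitivity; [|apply plus_zero_r].
    exact (f_equal (plus (opp a)) H).
Qed.

Definition mirror (v : vec) : vec := (- fst v, snd v).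

Lemma vsum_mirror (w : list vec) : vsum (map mirror w) = mirror (vsum w).
Proof.
  induction w as [|u w IH]; simpl; [|rewrite IH];
    apply vec_eq; unfold mirror, plus, zero; simpl; unfold plus, zero; simpl; ring.
Qed.

(** The normed-module structure on pairs, named so that general norm lemmas
    can be instantiated at it: unification does not find it from a pair type. *)
Definition plane : NormedModule R_AbsRing :=
  prod_NormedModule R_AbsRing R_NormedModule R_NormedModule.

Lemma norm_vec_eq (v : vec) : norm v = sqrt (fst v ^ 2 + snd v ^ 2).
Proof.
  destruct v as [x y].
  change (norm ((x, y) : vec)) with (sqrt (Rabs x ^ 2 + Rabs y ^ 2)).
  now rewrite !pow2_abs.
Qed.

Lemma norm_mirror (v : vec) : norm (mirror v) = norm v.
Proof. rewrite !norm_vec_eq; unfold mirror; simpl; f_equal; ring. Qed.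

Lemma norm_lt_of_sq (v : vec) (r : R) :
  0 < r -> fst v ^ 2 + snd v ^ 2 < r ^ 2 -> norm v < r.
Proof.
  intros Hr H. rewrite norm_vec_eq, <- (sqrt_pow2 r) by lra.
  apply sqrt_lt_1; [nra | nra | exact H].
Qed.

Fixpoint total_length (w : list vec) : R :=
  match w with [] => 0 | u :: w' => norm u + total_length w' end.

Lemma total_length_app (w1 w2 : list vec) :
  total_length (w1 ++ w2) = total_length w1 + total_length w2.
Proof.
  induction w1 as [|u w1 IH]; simpl; [|rewrite IH]; ring.
Qed.

Lemma total_length_rev (w : list vec) : total_length (rev w) = total_length w.
Proof.
  induction w as [|u w IH]; [reflexivity|].
  simpl rev. rewrite total_length_app, IH; simpl; ring.
Qed.

Lemma norm_vsum_le (w : list vec) : norm (vsum w) <= total_length w.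
Proof.
  induction w as [|u w IH]; simpl.
  - right. apply (norm_zero (V := plane)).
  - eapply Rle_trans; [apply (norm_triangle (V := plane))|].
    now apply Rplus_le_compat_l.
Qed.

Lemma total_length_firstn_le (n : nat) (w : list vec) :
  total_length (firstn n w) <= total_length w.
Proof.
  rewrite <- (firstn_skipn n w) at 2. rewrite total_length_app.
  assert (H : 0 <= total_length (skipn n w)).
  { eapply Rle_trans; [apply (norm_ge_0 (V := plane))|apply norm_vsum_le]. }
  lra.
Qed.

(** * The constants *)

Lemma sc_sq : s ^ 2 = 586756 / 625565 /\ c ^ 2 = 38809 / 625565.
Proof.
  assert (H : sqrt 625565 ^ 2 = 625565) by (apply pow2_sqrt; lra).
  assert (H0 : sqrt 625565 <> 0) by (intros E; rewrite E in H; lra).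
  unfold s, c. split; rewrite <- H at 2; field; exact H0.
Qed.

Lemma s_sq_c_sq : s ^ 2 + c ^ 2 = 1.
Proof. destruct sc_sq; lra. Qed.

Lemma s_mul_c : s * c = 150902 / 625565.
Proof.
  assert (E : 197 * s = 766 * c) by (unfold s, c; field; apply Rgt_not_eq, sqrt_lt_R0; lra).
  destruct sc_sq. nra.
Qed.

(** The tight inequality 1 + mu^2 + 2 mu s < Rhat^2 leaves room for an error of
    about 2.8e-5 in s, whose value is 0.9684842... *)
Lemma s_bounds : 0 < s < 0.96851.
Proof.
  assert (0 < s) by (apply Rdiv_lt_0_compat; [lra | apply sqrt_lt_R0; lra]).
  destruct sc_sq. split; nra.
Qed.

(** The state starting at Z_2 has length 4sc + 2 mu (3 - 4c^2) c with sc and c^2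
    rational, so an error of about 4.8e-6 in c = 0.2490749... is affordable. *)
Lemma c_bounds : 0 < c < 0.249076.
Proof.
  assert (0 < c) by (apply Rdiv_lt_0_compat; [lra | apply sqrt_lt_R0; lra]).
  destruct sc_sq. split; nra.
Qed.

(** Unfolds an equation between coordinates of the given vectors to a polynomial
    equation in s, c and mu. *)
Ltac coords :=
  repeat (unfold vsum, P, Q, P1, P2, P3, P4, Q1, Q2, Q3, Q4, Z1, Z2, d1, d2,
          mirror, plus, zero, opp, scal; simpl);
  unfold mult; simpl.

(** Proves the polynomial identities that hold modulo s^2 + c^2 = 1.  The
    constants become variables so that this relation generates the whole ideal. *)
Ltac unit_circle :=
  let H := fresh in
  pose proof s_sq_c_sq as H; simpl in H; coords; clear - H;
  revert H; generalize s c mu; intros; nsatz.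

(** * One half of the sequence *)

Definition half (k : nat) : list vec := rev (firstn k P) ++ d1 :: skipn k P.

Lemma length_half (k : nat) : (k <= 4)%nat -> length (half k) = 5%nat.
Proof.
  intros Hk. unfold half.
  rewrite length_app, length_rev, length_firstn; cbn [length].
  rewrite length_skipn; cbn [P length]. lia.
Qed.

(** The reversal matches the descending block of Q with the descending block of
    P: since Q_i is the reflection of P_{5-i}, the block Q_4, ..., Q_{5-l} read
    backwards reflects to P_l, ..., P_1. *)
Lemma order_mirror (k l : nat) : (l <= 4)%nat ->
  order k l = half k ++ Z1 :: Z2 :: map mirror (rev (half l)).
Proof.
  intros Hl.
  assert (E1 : mirror P1 = Q4) by (apply vec_eq; coords; ring).
  assert (E2 : mirror P2 = Q3) by (apply vec_eq; coords; ring).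
  assert (E3 : mirror P3 = Q2) by (apply vec_eq; coords; ring).
  assert (E4 : mirror P4 = Q1) by (apply vec_eq; coords; ring).
  assert (Ed : mirror d1 = d2) by (apply vec_eq; coords; ring).
  assert (T : firstn (4 - l) Q ++ d2 :: rev (skipn (4 - l) Q)
              = map mirror (rev (half l))).
  { unfold half.
    do 5 (destruct l as [|l];
      [cbn [P Q firstn skipn rev app map Nat.sub];
       rewrite E1, E2, E3, E4, Ed; reflexivity|]).
    lia. }
  unfold order; cbn [app] in *; rewrite T. unfold half. now rewrite <- app_assoc.
Qed.

(** The position of d_1 does not affect the sum; the remaining simplification is
    that P_1 + P_3 and P_4 are reflections of each other in the horizontal axis,
    so that only P_2 contributes to the vertical part of P_1 + ... + P_4. *)
Lemma vsum_half (k : nat) :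
  vsum (half k) = (2 * (s * c) + 2 * mu * (3 - 4 * c ^ 2) * c, 2 * c ^ 2 - 1).
Proof.
  transitivity (vsum (d1 :: P)).
  - change (vsum (d1 :: P)) with (plus d1 (vsum P)).
    rewrite <- (firstn_skipn k P), vsum_app, plus_assoc, (plus_comm d1), <- plus_assoc.
    unfold half. now rewrite vsum_app, vsum_rev.
  - apply vec_eq; unit_circle.
Qed.

(** Bounds every sum of distinct P_i at once, by the triangle inequality: the
    total is about 0.72, so no finer estimate is needed for those states. *)
Lemma total_length_P : total_length P < Rhat.
Proof.
  pose proof c_bounds as Hc.
  assert (Hmu : 0 < mu) by (unfold mu; lra).
  assert (E1 : norm P1 = mu).
  { rewrite norm_vec_eq, <- (sqrt_pow2 mu) by lra. f_equal; unit_circle. }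
  assert (E2 : norm P2 = 2 * c).
  { rewrite norm_vec_eq, <- (sqrt_pow2 (2 * c)) by lra. f_equal; unit_circle. }
  assert (E3 : norm P3 = 2 * c * mu).
  { rewrite norm_vec_eq, <- (sqrt_pow2 (2 * c * mu)) by nra. f_equal; unit_circle. }
  assert (E4 : norm P4 = mu).
  { rewrite norm_vec_eq, <- (sqrt_pow2 mu) by lra. f_equal; unit_circle. }
  simpl. rewrite E1, E2, E3, E4. unfold mu, Rhat. lra.
Qed.

Lemma corner_sq_lt : 1 + mu ^ 2 + 2 * mu * s < Rhat ^ 2.
Proof. pose proof s_bounds. unfold mu, Rhat. lra. Qed.

(** The points of the polygonal path from d_1 with steps P_1, ..., P_4.  The
    points for m = 1, 2, 3 lie on one circle about the origin, of squared radius
    1 + mu^2 + 2 mu s; values m >= 4 all give the endpoint. *)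
Lemma norm_down_P_lt (m : nat) :
  norm (plus d1 (vsum (firstn m P))) < Rhat.
Proof.
  assert (HR : 0 < Rhat) by (unfold Rhat; lra).
  pose proof corner_sq_lt as HB.
  destruct m as [|[|[|[|m]]]]; apply norm_lt_of_sq; try exact HR.
  - unfold Rhat; coords; lra.
  - eapply Rle_lt_trans; [right|exact HB]. unit_circle.
  - eapply Rle_lt_trans; [right|exact HB]. unit_circle.
  - eapply Rle_lt_trans; [right|exact HB]. unit_circle.
  - change (plus d1 (vsum (firstn (S (S (S (S m)))) P)))
      with (plus d1 (vsum (P ++ firstn m []))).
    rewrite firstn_nil, app_nil_r.
    change (plus d1 (vsum P)) with (vsum (half 0)).
    rewrite vsum_half; cbn [fst snd].
    pose proof c_bounds as Hcb. pose proof s_mul_c as Hsc. destruct sc_sq as [_ Hc].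
    rewrite Hsc, Hc. unfold mu, Rhat. nra.
Qed.

Lemma firstn_add {A : Type} (m n : nat) (w : list A) :
  firstn (m + n) w = firstn m w ++ firstn n (skipn m w).
Proof.
  revert w; induction m as [|m IH]; intros [|a w]; simpl; trivial.
  - now rewrite firstn_nil.
  - now rewrite IH.
Qed.

(** The insertion point k of d_1 only decides where the path is entered: after
    d_1 the prefix contains P_1, ..., P_k and then an initial part of the rest,
    whence the partial sums of P in their natural order. *)
Lemma norm_prefix_half_lt (k n : nat) :
  (k <= 4)%nat -> norm (vsum (firstn n (half k))) < Rhat.
Proof.
  intros Hk. unfold half.
  assert (L : length (rev (firstn k P)) = k).
  { rewrite length_rev, length_firstn; simpl; lia. }
  destruct (Nat.le_gt_cases n k) as [Hn|Hn].
  - rewrite firstn_app, L. replace (n - k)%nat with 0%nat by lia.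
    simpl firstn at 2. rewrite app_nil_r.
    eapply Rle_lt_trans; [apply norm_vsum_le|].
    eapply Rle_lt_trans; [apply total_length_firstn_le|].
    rewrite total_length_rev.
    eapply Rle_lt_trans; [apply total_length_firstn_le|apply total_length_P].
  - destruct (Nat.le_exists_sub (S k) n Hn) as [j [-> _]].
    replace (j + S k)%nat with (length (rev (firstn k P)) + S j)%nat by lia.
    rewrite firstn_app_2, vsum_app, vsum_rev.
    simpl firstn at 2; simpl vsum at 2.
    rewrite plus_assoc, (plus_comm _ d1), <- plus_assoc, <- vsum_app, <- firstn_add.
    apply norm_down_P_lt.
Qed.

(** * Assembling the two halves *)

Lemma vsum_halves (k l : nat) :
  plus (vsum (half k)) (vsum (Z1 :: Z2 :: map mirror (rev (half l)))) = zero.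
Proof.
  change (plus (vsum (half k)) (plus Z1 (plus Z2 (vsum (map mirror (rev (half l)))))) = zero).
  rewrite vsum_mirror, vsum_rev, !vsum_half.
  apply vec_eq; unit_circle.
Qed.

(** Z_2 has vertical part s^2 - c^2 = 1 - 2c^2, the opposite of that of a half, so
    this state is horizontal, and its horizontal part -x is -2sc from Z_2 plus
    the reflected sum of a half. *)
Lemma norm_middle_lt (l : nat) :
  norm (vsum (Z2 :: map mirror (rev (half l)))) < Rhat.
Proof.
  simpl vsum. rewrite vsum_mirror, vsum_rev, vsum_half.
  pose proof c_bounds. pose proof s_mul_c as Hsc.
  destruct sc_sq as [_ Hc].
  set (x := 4 * (s * c) + 2 * mu * (3 - 4 * c ^ 2) * c).
  assert (E : plus Z2 (mirror (2 * (s * c) + 2 * mu * (3 - 4 * c ^ 2) * c, 2 * c ^ 2 - 1))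
              = (- x, 0)).
  { apply vec_eq; unfold x; unit_circle. }
  rewrite E.
  assert (0 < x < Rhat) by (unfold x; rewrite Hsc, Hc; unfold mu, Rhat; lra).
  apply norm_lt_of_sq; simpl; nra.
Qed.

Theorem lemma5p2 :
  forall k l : nat, (k <= 4)%nat -> (l <= 4)%nat ->
  forall v : R * R, suffix_state (order k l) v -> v <> (0, 0) ->
  norm v < Rhat.
Proof.
  intros k l Hk Hl v [i [_ ->]] _.
  rewrite order_mirror by exact Hl.
  generalize (i - 1)%nat; clear i; intros n.
  rewrite skipn_app, (length_half k Hk), vsum_app.
  destruct (Nat.le_gt_cases n 5) as [Hn|Hn].
  (* The suffix starts in the first half, or at Z_1 when n = 5: the total being
     zero, it is the opposite of a prefix of the first half. *)
  - replace (n - 5)%nat with 0%nat by lia. simpl skipn at 2.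
    replace (plus _ _) with (opp (vsum (firstn n (half k)))).
    { rewrite (norm_opp (V := plane)). now apply norm_prefix_half_lt. }
    pose proof (vsum_halves k l) as H.
    rewrite <- (firstn_skipn n (half k)), vsum_app, <- plus_assoc in H.
    symmetry. now apply plus_eq_zero_opp.
  - rewrite (skipn_all2 (half k)) by (rewrite length_half; lia).
    simpl vsum at 1. rewrite plus_zero_l.
    destruct (n - 5)%nat as [|[|m]] eqn:E; [lia| |].
    + apply norm_middle_lt.
    (* A suffix of the reversed half is a reversed prefix. *)
    + simpl skipn. rewrite skipn_map, skipn_rev, vsum_mirror, vsum_rev, norm_mirror.
      now apply norm_prefix_half_lt.
Qed.
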